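(* There is no deterministic (or randomized) Bayesian incentive compatible mechanism for allocating indivisible items among agents with additive valuations that outputs fPO allocations that are fulfilling.
   Context: Setting: a set of $m$ indivisible items $[m]$ is to be allocated among $n$ agents $[n]$. Each agent $i$ has a private valuation vector $\mathbf v_i=(v_{i,1},\dots,v_{i,m})\in\mathbb R^m_{\ge 0}$. A (deterministic) allocation is $\mathbf x\in\{0,1\}^{n\times m}$ with $\sum_i x_{i,j}=1$ for every item $j$. A randomized allocation is a probability distribution over deterministic allocations, with $x_{i,j}\in[0,1]$ denoting the probability that item $j$ is assigned to agent $i$. Utilities are additive: $u_i(\mathbf x)=\sum_j v_{i,j}x_{i,j}$. A mechanism takes the agents' reports $\mathbf b=(\mathbf b_1,\dots,\mathbf b_n)$ and outputs an allocation $\mathbf x(\mathbf b)$; a randomized mechanism may choose this allocation at random. Bayesian incentive compatibility (BIC): each agent $i$'s valuation $\mathbf v_i$ is drawn from a known prior distribution $\mathcal D_i$. A mechanism is BIC for the priors $\times_{i=1}^n\mathcal D_i$ if truthful reporting is a Bayesian Nash equilibrium, i.e., for every agent $i$, valuation $\mathbf v_i$ and report $\mathbf b_i$, $\mathbb E_{\mathbf v_{-i}\sim\mathcal D_{-i}}[u_i(\mathbf x(\mathbf v_i,\mathbf v_{-i}))]\ge\mathbb E_{\mathbf v_{-i}\sim\mathcal D_{-i}}[u_i(\mathbf x(\mathbf b_i,\mathbf v_{-i}))]$, where $u_i$ is computed with the true $\mathbf v_i$ and $\mathcal D_{-i}=\times_{k\ne i}\mathcal D_k$ (for a randomized mechanism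 the expectation is also over its randomness). The theorem's statement does not name a particular prior. fPO (fractional Pareto optimality): an allocation $\mathbf x$ is (ex-post) fPO if no randomized allocation $\mathbf y$ Pareto dominates it, i.e., there is no randomized $\mathbf y$ with $u_i(\mathbf y)\ge u_i(\mathbf x)$ for all $i$ and $u_j(\mathbf y)>u_j(\mathbf x)$ for some $j$. Fulfilling: an allocation is fulfilling if, for every agent $i$, whenever $i$ has at least $n$ items that she values positively, agent $i$ gets a bundle of positive utility. *)

(* Defs.v *)
From HB Require Import structures.
From mathcomp Require Import all_boot all_order all_algebra.
From mathcomp Require Import all_classical all_reals all_analysis.

Set Implicit Arguments.
Unset Strict Implicit.
Unset Printing Implicit Defensive.

Import Order.TTheory GRing.Theory Num.Theory.
Import numFieldNormedType.Exports.

Local Open Scope classical_set_scope.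
Local Open Scope ring_scope.

Definition nnreal (R : realType) : Type := {nonneg R}.

Definition nnval (R : realType) (x : nnreal R) : R := (x : {nonneg R})%:num.

(* [0, +oo[ carries the trace of the Borel sigma-algebra of R. *)
HB.instance Definition _ (R : realType) := Choice.on (nnreal R).
HB.instance Definition _ (R : realType) :=
  isPointed.Build (nnreal R) (0%:nng : {nonneg R}).
HB.instance Definition _ (R : realType) := Measurable.copy (nnreal R)
  (g_sigma_algebra_preimageType (@nnval R : nnreal R -> measurableTypeR R)).

Definition valuation (R : realType) (m : nat) := m.-tuple (nnreal R).

Definition profile (R : realType) (n m : nat) := n.-tuple (valuation R m).

Definition value (R : realType) (m : nat) (v : valuation R m) (j : 'I_m) : R :=
  nnval (tnth v j).

Section ProductMeasure.
Context d (T : measurableType d) (R : realType).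

Definition tuple_cons (n : nat) (x : T * n.-tuple T) : n.+1.-tuple T :=
  [tuple of x.1 :: x.2].

Lemma measurable_tuple_cons (n : nat) :
  measurable_fun [set: T * n.-tuple T] (@tuple_cons n).
Proof. exact: measurable_cons measurable_fst measurable_snd. Qed.

HB.instance Definition _ (n : nat) :=
  isMeasurableFun.Build _ _ _ _ (@tuple_cons n) (@measurable_tuple_cons n).

Fixpoint product_measure (n : nat) :
    ('I_n -> probability T R) -> probability (n.-tuple T) R :=
  if n is n'.+1 return ('I_n -> probability T R) -> probability (n.-tuple T) R
  then fun D =>
    distribution (D ord0 \x product_measure (fun k => D (lift ord0 k)))%E
      (@tuple_cons n')
  else fun=> \d_ ([tuple] : 0.-tuple T).

Lemma product_measureE (n : nat) (D : 'I_n -> probability T R)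
    (A : 'I_n -> set T) : (forall k, measurable (A k)) ->
  product_measure D [set w | forall k, A k (tnth w k)] = (\prod_k D k (A k))%E.
Proof.
elim: n D A => [|n IHn] D A mA /=.
  rewrite big_ord0 diracE mem_set// => k; by case: k.
rewrite big_ord_recl -IHn; last by move=> k; exact: mA.
rewrite /distribution /pushforward -product_measure1E//.
  congr (_ _); apply/seteqP; split=> [[x w] /= H|[x w] /= [H0 H] k].
    split=> [|k]; first by have := H ord0.
    by have := H (lift ord0 k); rewrite /tuple_cons tnthS.
  case: (unliftP ord0 k) => [j ->|->]; rewrite ?tnthS//.
rewrite (_ : [set _ | _] = \bigcap_k [set w : n.-tuple T | A (lift ord0 k) (tnth w k)]).
  apply: fin_bigcap_measurable => // k _.
  rewrite -[X in measurable X]setTI.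
  exact: (@measurable_tnth _ T n k measurableT _ (mA _)).
by apply/seteqP; split=> w /= H k; [move=> _; exact: H | exact: H].
Qed.

End ProductMeasure.

Section Allocation.
Context (R : realType) (n m : nat).

(* a j is the agent receiving item j; [alloc_mx] is the 0/1 matrix view. *)
Definition alloc := {ffun 'I_m -> 'I_n}.

Definition alloc_mx (a : alloc) : 'M[R]_(n, m) :=
  \matrix_(i < n, j < m) (a j == i)%:R.

Record lottery := Lottery {
  prob :> alloc -> R;
  prob_ge0 : forall a, 0 <= prob a;
  prob_sum1 : \sum_a prob a = 1 }.

Definition lottery_mx (p : lottery) : 'M[R]_(n, m) :=
  \matrix_(i < n, j < m) \sum_(a : alloc | a j == i) p a.

Definition utility (v : valuation R m) (i : 'I_n) (x : 'M[R]_(n, m)) : R :=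
  \sum_(j < m) value v j * x i j.

Definition pareto_dominates (v : profile R n m) (y x : 'M[R]_(n, m)) : Prop :=
  (forall i, utility (tnth v i) i x <= utility (tnth v i) i y) /\
  (exists i, utility (tnth v i) i x < utility (tnth v i) i y).

Definition fPO (v : profile R n m) (a : alloc) : Prop :=
  ~ exists y : lottery, pareto_dominates v (lottery_mx y) (alloc_mx a).

Definition fulfilling (v : profile R n m) (a : alloc) : Prop :=
  forall i, (n <= #|[set j | (0 < value (tnth v i) j)%R]%SET|)%N ->
    0 < utility (tnth v i) i (alloc_mx a).

Definition others (D : 'I_n -> probability (valuation R m) R) (i : 'I_n) :
    probability (n.-1.-tuple (valuation R m)) R :=
  product_measure (fun k : 'I_n.-1 => D (lift i k)).

Definition with_report (i : 'I_n) (b : valuation R m)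
    (w : n.-1.-tuple (valuation R m)) : profile R n m :=
  [tuple if unlift i k is Some l then tnth w l else b | k < n].

(* Utilities are linear in the allocation matrix, so for a randomized mechanism
   the expectation over its own randomness is the utility of the matrix of
   assignment probabilities. *)
Definition BIC (D : 'I_n -> probability (valuation R m) R)
    (x : profile R n m -> 'M[R]_(n, m)) : Prop :=
  forall (i : 'I_n) (v b : valuation R m),
    ('E_(others D i)[fun w => utility v i (x (with_report i b w))] <=
     'E_(others D i)[fun w => utility v i (x (with_report i v w))])%E.

(* Without measurability the expectations in [BIC] would be meaningless. *)
Definition measurable_rule (x : profile R n m -> 'M[R]_(n, m)) : Prop :=
  forall i j, measurable_fun [set: profile R n m] (fun b => x b i j).

Definition deterministic_BIC_fPO_fulfilling
    (D : 'I_n -> probability (valuation R m) R)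
    (M : profile R n m -> alloc) : Prop :=
  [/\ measurable_rule (fun b => alloc_mx (M b)),
      BIC D (fun b => alloc_mx (M b)),
      forall b, fPO b (M b) &
      forall b, fulfilling b (M b)].

(* fPO and fulfilling are required ex post, of every allocation in the support. *)
Definition randomized_BIC_fPO_fulfilling
    (D : 'I_n -> probability (valuation R m) R)
    (M : profile R n m -> lottery) : Prop :=
  [/\ measurable_rule (fun b => lottery_mx (M b)),
      BIC D (fun b => lottery_mx (M b)),
      forall b a, 0 < M b a -> fPO b a &
      forall b a, 0 < M b a -> fulfilling b a].

End Allocation.

(* Main.v *)
(* Take two agents, two items and Dirac priors. When both agents value both
   items, being fulfilling gives one item to each, and fPO decides which one:
   against an agent with values (2, 1), an agent with values (s, t) gets the
   first item if s > 2t and the second one if s < 2t. An agent with values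
   (3, 2) therefore gets utility 2 when truthful, but 3 when reporting (3, 1).
   Interim incentive compatibility against a Dirac prior is incentive
   compatibility against the fixed report (2, 1), so such a mechanism cannot
   be BIC. *)
Require Import Defs.
From mathcomp Require Import all_boot all_order all_algebra.
From mathcomp Require Import all_classical all_reals all_analysis.
From mathcomp Require Import measurable_realfun lra.

Set Implicit Arguments.
Unset Strict Implicit.
Unset Printing Implicit Defensive.

Import Order.TTheory GRing.Theory Num.Theory.

Local Open Scope classical_set_scope.
Local Open Scope ring_scope.

(** By induction on [n]: integrating the measure of the sections of [A] against the Dirac mass of
    the head evaluates it at [p ord0], and the induction hypothesis applies to that section. *)
Lemma product_measure_dirac d (T : measurableType d) (R : realType) (n : nat)
    (p : 'I_n -> T) (A : set (n.-tuple T)) :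
  measurable A ->
  product_measure (fun k => \d_(p k) : probability T R) A =
  \d_([tuple p k | k < n]) A.
Proof.
elim: n p A => [|n IHn] p A mA /=.
  by rewrite (_ : [tuple p k | k < 0] = [tuple]) //; apply: tuple0.
have mB : measurable (@tuple_cons d T n @^-1` A).
  by rewrite -[X in measurable X]setTI; exact: measurable_tuple_cons.
rewrite /distribution /pushforward /product_measure1 integral_dirac//.
  rewrite diracT mul1e /= (IHn (fun k => p (lift ord0 k))).
    rewrite !diracE; congr ((nat_of_bool _)%:R%:E).
    have -> : [tuple p k | k < n.+1] =
        tuple_cons (p ord0, [tuple p (lift ord0 k) | k < n]).
      apply/eq_from_tnth => k; case: (unliftP ord0 k) => [j ->|->].
        by rewrite tnthS !tnth_mktuple.
      by rewrite tnth_mktuple.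
    by apply/idP/idP; rewrite !inE /xsection /= inE.
  exact: measurable_xsection.
exact: measurable_fun_xsection.
Qed.

Section DiracPrior.
Context (R : realType) (n m : nat).
Implicit Types (i : 'I_n) (b v : valuation R m) (p : profile R n m).

Definition dirac_prior p (k : 'I_n) : probability (valuation R m) R :=
  \d_(tnth p k).

Definition deviate i b p : profile R n m :=
  with_report i b [tuple tnth p (lift i k) | k < n.-1].

Lemma measurable_with_report i b :
  measurable_fun [set: n.-1.-tuple (valuation R m)] (with_report i b).
Proof.
apply/measurable_fun_tnthP => k.
rewrite (_ : _ \o _ = fun w : n.-1.-tuple (valuation R m) =>
    if unlift i k is Some l then tnth w l else b); last first.
  by apply/funext => w /=; rewrite tnth_mktuple.
by case: (unlift i k) => [l|]; [exact: measurable_tnth|exact: measurable_cst].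
Qed.

Lemma expectation_others_dirac p i (f : n.-1.-tuple (valuation R m) -> R) :
  measurable_fun setT f ->
  ('E_(others (dirac_prior p) i)[f] =
    (f [tuple tnth p (lift i k) | k < n.-1])%:E)%E.
Proof.
move=> mf; rewrite unlock.
(* Agreement of the two measures on measurable sets is enough to exchange them under the
   integral. *)
rewrite (eq_measure_integral
    (\d_([tuple tnth p (lift i k) | k < n.-1]))); last first.
  by move=> A mA _; exact: product_measure_dirac.
rewrite integral_dirac ?diracT ?mul1e//.
exact/measurable_EFinP.
Qed.

Lemma measurable_utility_report (x : profile R n m -> 'M[R]_(n, m)) i v b :
  measurable_rule x ->
  measurable_fun setT (fun w => utility v i (x (with_report i b w))).
Proof.
move=> mx; apply: measurable_sum => j; apply: measurable_funM.
  exact: measurable_cst.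
by apply: (measurableT_comp (mx i j)); exact: measurable_with_report.
Qed.

(** Both expectations are evaluations at the one profile of the others charged by the prior, so the
    interim inequality becomes a pointwise one. *)
Lemma BIC_dirac p (x : profile R n m -> 'M[R]_(n, m)) i v b :
  measurable_rule x -> BIC (dirac_prior p) x ->
  utility v i (x (deviate i b p)) <= utility v i (x (deviate i v p)).
Proof.
move=> mx /(_ i v b); rewrite !expectation_others_dirac ?lee_fin//;
  exact: measurable_utility_report.
Qed.

End DiracPrior.

Section Lotteries.
Context (R : realType) (n m : nat).
Implicit Types (a b c : alloc n m) (p : lottery R n m).

(** For distinct [a] and [b] this is a fair coin flip, used to build dominating lotteries; for
    [a = b] it is the point mass, used to embed deterministic mechanisms. *)
Definition fair_mix_prob a b c : R := ((c == a)%:R + (c == b)%:R) / 2.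

Lemma fair_mix_prob_ge0 a b c : 0 <= fair_mix_prob a b c.
Proof. by rewrite divr_ge0 ?addr_ge0. Qed.

(** [predT] yields total mass; [c j == i] yields assignment probabilities. *)
Lemma sum_indicator a (P : pred (alloc n m)) :
  \sum_(c | P c) (c == a)%:R = (P a)%:R :> R.
Proof.
rewrite big_mkcond (bigD1 a)//= eqxx big1 ?addr0 => [|c /negPf ->].
  by case: (P a).
by case: ifP.
Qed.

Lemma fair_mix_prob_sum1 a b : \sum_c fair_mix_prob a b c = 1.
Proof.
rewrite -mulr_suml big_split /= !(sum_indicator _ predT) /=.
by rewrite divff// pnatr_eq0.
Qed.

Definition fair_mix a b : lottery R n m :=
  Lottery (fair_mix_prob_ge0 a b) (fair_mix_prob_sum1 a b).

Lemma fair_mix_mx a b i j :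
  lottery_mx (fair_mix a b) i j = ((a j == i)%:R + (b j == i)%:R) / 2.
Proof.
rewrite !mxE -mulr_suml big_split /=.
by rewrite !(sum_indicator _ (fun c : alloc n m => c j == i)).
Qed.

(** Nonnegativity makes the probabilities off [a] vanish, so all the mass sits at [a]. *)
Lemma lottery_mx_point p a :
  (forall c, 0 < p c -> c = a) -> lottery_mx p = alloc_mx R a.
Proof.
move=> pa.
have p0 c : c != a -> p c = 0.
  move=> ca; apply/eqP; apply: contraNT ca => pc.
  by apply/eqP/pa; rewrite lt0r pc prob_ge0.
have pE c : p c = (c == a)%:R.
  have [->|/p0 //] := eqVneq c a.
  by rewrite -(prob_sum1 p) (bigD1 a)//= big1 ?addr0.
apply/matrixP => i j; rewrite !mxE.
under eq_bigr do rewrite pE.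
exact: (sum_indicator a (fun c => c j == i)).
Qed.

Lemma fair_mix_self_supp a c : 0 < fair_mix a a c -> c = a.
Proof.
rewrite /= /fair_mix_prob.
by have [//|_] := eqVneq c a; rewrite addr0 mul0r ltxx.
Qed.

(** Reduces the deterministic impossibility to the randomized one. *)
Lemma deterministic_randomized (D : 'I_n -> probability (valuation R m) R)
    (M : profile R n m -> alloc n m) :
  deterministic_BIC_fPO_fulfilling D M ->
  randomized_BIC_fPO_fulfilling D (fun v => fair_mix (M v) (M v)).
Proof.
have mxE : (fun v => lottery_mx (fair_mix (M v) (M v))) =
           (fun v => alloc_mx R (M v)).
  by apply/funext => v; exact/lottery_mx_point/fair_mix_self_supp.
by case=> mM bicM pM fM; split; rewrite ?mxE// => v c /fair_mix_self_supp ->.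
Qed.

End Lotteries.

Section TwoAgentsTwoItems.
Context (R : realType).
Implicit Types (v w : valuation R 2) (a : alloc 2 2).

Notation i0 := (ord0 : 'I_2).
Notation i1 := (ord_max : 'I_2).

Definition val2 (s t : nat) : valuation R 2 :=
  [tuple (s%:R%:nng : {nonneg R}); (t%:R%:nng : {nonneg R})].

Definition alloc2 (i j : 'I_2) : alloc 2 2 :=
  [ffun k => if k == i0 then i else j].

Lemma alloc2E a : a = alloc2 (a i0) (a i1).
Proof.
apply/ffunP => k; rewrite ffunE; case: eqP => [->//|/eqP k0].
by congr (a _); apply/val_inj; move: k0; case: k => [[|[|k]] hk].
Qed.

Lemma utility_val2 (s t : nat) i (x : 'M[R]_2) :
  utility (val2 s t) i x = s%:R * x i i0 + t%:R * x i i1.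
Proof.
rewrite /utility !big_ord_recl big_ord0 addr0.
by congr (_ * _ + _ * x _ _); apply/val_inj.
Qed.

Lemma deviate0 v w b : deviate i0 b [tuple v; w] = [tuple b; w].
Proof.
apply/eq_from_tnth => k; rewrite tnth_mktuple.
case: (unliftP i0 k) => [j ->|->//].
by rewrite tnth_mktuple; case: j => [[|j] hj].
Qed.

Lemma fulfilling_gets_item (p : profile R 2 2) (s t : nat) i a :
  (0 < s)%N -> (0 < t)%N -> tnth p i = val2 s t -> fulfilling p a ->
  (a i0 == i) || (a i1 == i).
Proof.
move=> s0 t0 pi /(_ i); rewrite pi utility_val2 !mxE => H.
apply: contraLR isT => /norP[/negPf n0 /negPf n1]; move: H.
rewrite n0 n1 !mulr0 addr0 ltxx => H; apply/negP => _.
suff /H : (2 <= #|[set j | (0 < value (val2 s t) j)%R]%SET|)%N by [].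
(* Both items are valued positively, which meets the threshold of two items for two agents. *)
rewrite (_ : [set j | _]%SET = [set: 'I_2]%SET) ?cardsT ?card_ord//.
apply/setP => j; rewrite !inE /value.
by case: (unliftP i0 j) => [k|] ->; rewrite ?tnthS /= ?ltr0n//;
  case: k => [[|k] hk] //; rewrite /tnth /= ltr0n.
Qed.

(* The second agent is indifferent between [i1] and half of [i0]; this is the
   trade that dominates the other allocation giving one item to each agent. *)
Lemma fPO_fulfilling_alloc2 (s t : nat) a
    (p := [tuple val2 s t; val2 2 1] : profile R 2 2) :
  (0 < s)%N -> (0 < t)%N -> s != t.*2 -> fPO p a -> fulfilling p a ->
  a = if (t.*2 < s)%N then alloc2 i0 i1 else alloc2 i1 i0.
Proof.
move=> s0 t0 st pa fa.
have get0 := fulfilling_gets_item s0 t0 (erefl : tnth p i0 = _) fa.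
have get1 := fulfilling_gets_item (ltn0Sn 1) (ltn0Sn 0)
  (erefl : tnth p i1 = _) fa.
have undominated y : ~ pareto_dominates p (lottery_mx y) (alloc_mx R a).
  by move=> ya; apply: pa; exists y.
have ord2 (k : 'I_2) : k = i0 \/ k = i1.
  by case: k => [[|[|k]] hk]; [left|right|]; try exact/val_inj.
have aE := alloc2E a.
(* Allocations giving both items to one agent contradict [get0] or [get1]; two cases remain. *)
case: (ord2 (a i0)) => a0; case: (ord2 (a i1)) => a1;
  rewrite a0 a1 in aE get0 get1 => //; rewrite {}aE in undominated *.
- case: ltnP => // ts.
  have {}ts : (s%:R < 2 * t%:R :> R).
    by rewrite -natrM ltr_nat mul2n ltn_neqAle st.
  (* Agent [i0] gives up half of the first item for the whole second one: her utility rises from [s]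
     to [s / 2 + t], while that of [i1] stays 1. *)
  case: (undominated (fair_mix R (alloc2 i0 i0) (alloc2 i1 i0))); split.
    move=> i; case: (ord2 i) => ->;
      by rewrite !utility_val2 !fair_mix_mx !mxE !ffunE /=; lra.
  by exists i0; rewrite !utility_val2 !fair_mix_mx !mxE !ffunE /=; lra.
- case: ltnP => // ts.
  have {}ts : (2 * t%:R < s%:R :> R) by rewrite -natrM ltr_nat mul2n.
  (* The reverse trade: agent [i0] goes from [t] to [s / 2], and [i1] keeps utility 2. *)
  case: (undominated (fair_mix R (alloc2 i0 i1) (alloc2 i1 i1))); split.
    move=> i; case: (ord2 i) => ->;
      by rewrite !utility_val2 !fair_mix_mx !mxE !ffunE /=; lra.
  by exists i0; rewrite !utility_val2 !fair_mix_mx !mxE !ffunE /=; lra.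
Qed.

Lemma no_randomized_mechanism (M : profile R 2 2 -> lottery R 2 2) :
  ~ randomized_BIC_fPO_fulfilling
      (dirac_prior [tuple val2 3 2; val2 2 1]) M.
Proof.
case=> mM bicM pM fM.
(* Away from the tie [s = 2t] the support is a single allocation, so randomization gives the
   mechanism no freedom. *)
have ME s t : (0 < s)%N -> (0 < t)%N -> s != t.*2 ->
    lottery_mx (M [tuple val2 s t; val2 2 1]) =
    alloc_mx R (if (t.*2 < s)%N then alloc2 i0 i1 else alloc2 i1 i0).
  move=> s0 t0 st; apply: lottery_mx_point => c Mc.
  exact: fPO_fulfilling_alloc2 (pM _ _ Mc) (fM _ _ Mc).
have := BIC_dirac i0 (val2 3 2) (val2 3 1) mM bicM.
by rewrite !deviate0 !ME// !utility_val2 !mxE !ffunE /=; lra.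
Qed.

End TwoAgentsTwoItems.

Theorem theorem6 (R : realType) :
  exists (n m : nat) (D : 'I_n -> probability (valuation R m) R),
    [/\ (0 < n)%N, (0 < m)%N,
        ~ (exists M : profile R n m -> alloc n m,
             deterministic_BIC_fPO_fulfilling D M) &
        ~ (exists M : profile R n m -> lottery R n m,
             randomized_BIC_fPO_fulfilling D M)].
Proof.
exists 2, 2, (dirac_prior [tuple val2 R 3 2; val2 R 2 1]); split=> //.
  by case=> M /deterministic_randomized /no_randomized_mechanism.
by case=> M /no_randomized_mechanism.
Qed.
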